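(* For all $q\ge 2$ and $n\in\mathbb{N}$, $\kappa^{\min}_{n,q}\ge \lfloor n/3\rfloor$.
   Context: Let $q\ge 2$, $A=\{0,1,\dots,q-1\}$, $[n]=\{1,\dots,n\}$, and let $F(n,q)$ be the set of all maps $A^n\to A^n$. For $f\in F(m,q)$ and $i\in[m]$, $f_i$ is the $i$-th coordinate function and $f^i(x)=(x_1,\dots,x_{i-1},f_i(x),x_{i+1},\dots,x_m)$; for a word $w=(w_1,\dots,w_t)$ over $[m]$, $f^w=f^{w_t}\circ\cdots\circ f^{w_1}$. $\Pi([m])$ is the set of permutations of $[m]$ written as words $(w_1,\dots,w_m)$. $\mathrm{pr}_{[n]}:A^m\to A^n$ is the projection onto the first $n$ coordinates. For $m\ge n$, $(f,w)$ with $f\in F(m,q)$, $w\in\Pi([m])$ sequentializes $h\in F(n,q)$ if $\mathrm{pr}_{[n]}\circ f^w=h\circ\mathrm{pr}_{[n]}$. $\kappa^{\min}(h)$ is the smallest $k\ge 0$ such that there exist $f\in F(n+k,q)$ and $w\in\Pi([n+k])$ with $(f,w)$ sequentializing $h$, and $\kappa^{\min}_{n,q}=\max\{\kappa^{\min}(h): h\in F(n,q)\}$. *)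

(* Defs.v *)
From mathcomp Require Import all_boot all_fingroup.
Set Implicit Arguments. Unset Strict Implicit. Unset Printing Implicit Defensive.

(* Coordinates [m] = {1..m} are represented by 'I_m = {0..m-1};
   the alphabet A = {0..q-1} is 'I_q; A^m is {ffun 'I_m -> 'I_q}. *)
Definition vec (m q : nat) := {ffun 'I_m -> 'I_q}.

Definition Fmap (m q : nat) := vec m q -> vec m q.

Definition upd (m q : nat) (f : Fmap m q) (i : 'I_m) (x : vec m q) : vec m q :=
  [ffun j => if j == i then f x i else x j].

Definition upd_word (m q : nat) (f : Fmap m q) (w : seq 'I_m) (x : vec m q) : vec m q :=
  foldl (fun y i => upd f i y) x w.

Definition perm_word (m : nat) (s : {perm 'I_m}) : seq 'I_m :=
  [seq s j | j <- enum 'I_m].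

Definition pr (n k q : nat) (x : vec (n + k) q) : vec n q :=
  [ffun i : 'I_n => x (lshift k i)].

Definition sequentializes (n k q : nat) (f : Fmap (n + k) q) (s : {perm 'I_(n + k)})
  (h : Fmap n q) : Prop :=
  forall x : vec (n + k) q, pr (upd_word f (perm_word s) x) = h (pr x).

Definition sequentializable_with (n q : nat) (h : Fmap n q) (k : nat) : Prop :=
  exists (f : Fmap (n + k) q) (s : {perm 'I_(n + k)}), sequentializes f s h.

Definition kappa_min_ge (n q : nat) (h : Fmap n q) (c : nat) : Prop :=
  forall k, sequentializable_with h k -> c <= k.

(* kappa_min_{n,q} >= c  <->  some h in F(n,q) has kappa_min(h) >= c *)
Definition kappa_max_ge (n q c : nat) : Prop :=
  exists h : Fmap n q, kappa_min_ge h c.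

(* Main.v *)
(** Put [m = n %/ 3] and split the coordinates into [m] control coordinates
    [C] and [2 m] data coordinates [D]; the others play no role. Whatever the
    order of the updates, at some time exactly [m] coordinates of [D] have been
    updated. Let [t] be the bit string marking those of [D] that are still
    pending. To every balanced string [t] we attach an [m]-dimensional subcube,
    free on the coordinates of [D] marked 0: the first half of [t] is written on
    [C] and the second half, in order, on the coordinates of [D] marked 1.
    A point of the subcube determines [t] by reading its bits one after the
    other, so the subcubes are pairwise disjoint, and [h] can be defined on each
    of them by copying the free coordinates onto those marked 1 and writing 0
    elsewhere. At the time considered, the [q ^ m] points of the subcube of [t]
    have become indistinguishable on [[n]] although their images under [h]
    differ; hence the [k] additional coordinates take [q ^ m] values. *)
Require Import Defs.
From mathcomp Require Import all_boot all_fingroup.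
From mathcomp Require Import zify.
Set Implicit Arguments. Unset Strict Implicit. Unset Printing Implicit Defensive.

(** The count grows by at most one per letter, so it skips no value. *)
Lemma count_take_ivt (T : Type) (P : pred T) (w : seq T) (c : nat) :
  c <= count P w -> exists t, count P (take t w) = c.
Proof.
elim: w c => [|x w IHw] c /=; first by exists 0; lia.
case: c => [|c] Hc; first by exists 0.
have [t tP] : exists t, count P (take t w) = c.+1 - P x by apply: IHw; lia.
by exists t.+1 => /=; rewrite tP; case: (P x) => //=; lia.
Qed.

Lemma count_mem_swap (T : eqType) (s1 s2 : seq T) :
  uniq s1 -> uniq s2 -> count [in s1] s2 = count [in s2] s1.
Proof.
move=> u1 u2; rewrite -!size_filter; apply/perm_size/uniq_perm.
- exact: filter_uniq.
- exact: filter_uniq.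
- by move=> x; rewrite !mem_filter andbC.
Qed.

Section Words.
Variables (m q : nat) (f : Fmap m q).

Lemma upd_word_cat w1 w2 x :
  upd_word f (w1 ++ w2) x = upd_word f w2 (upd_word f w1 x).
Proof. exact: foldl_cat. Qed.

Lemma upd_word_notin w x i : i \notin w -> upd_word f w x i = x i.
Proof.
elim: w x => [|j w IHw] x //=; rewrite inE negb_or => /andP[ij iw].
by rewrite IHw // ffunE (negPf ij).
Qed.

Lemma perm_word_uniq (s : {perm 'I_m}) : uniq (perm_word s).
Proof. by rewrite map_inj_uniq ?enum_uniq //; exact: perm_inj. Qed.

Lemma mem_perm_word (s : {perm 'I_m}) i : i \in perm_word s.
Proof. by apply/mapP; exists (s^-1%g i); rewrite ?mem_enum ?permKV. Qed.

End Words.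

(* At the time when [take t (perm_word s)] has been executed, the states reached
   from the inputs [g y] agree on the first [n] coordinates, so the [k]
   additional coordinates must tell them apart. *)
Lemma confusion_bound (n k q c t : nat) (h : Fmap n q.+2) (f : Fmap (n + k) q.+2)
    (s : {perm 'I_(n + k)}) (g : vec c q.+2 -> vec n q.+2) :
  sequentializes f s h ->
  injective (h \o g) ->
  (forall i y y', lshift k i \in take t (perm_word s) ->
     h (g y) i = h (g y') i) ->
  (forall i y y', lshift k i \notin take t (perm_word s) ->
     g y i = g y' i) ->
  c <= k.
Proof.
move=> seqf injhg updated pending.
set w := perm_word s in updated pending *.
pose start y : vec (n + k) q.+2 :=
  [ffun i => match split i with inl j => g y j | inr _ => ord0 end].
have startl y i : start y (lshift k i) = g y i.
  by rewrite ffunE; have -> : split (lshift k i) = inl i := unsplitK (inl i).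
have pr_start y : pr (start y) = g y by apply/ffunP => i; rewrite ffunE startl.
pose mid y := upd_word f (take t w) (start y).
have finE y : pr (upd_word f (drop t w) (mid y)) = h (g y).
  by rewrite -upd_word_cat cat_take_drop seqf pr_start.
(* [phi] keeps only the additional coordinates of the intermediate state; its injectivity gives
   [q.+2 ^ c <= q.+2 ^ k]. *)
pose phi y : vec k q.+2 := [ffun i => mid y (rshift n i)].
have injphi : injective phi.
  move=> y y' eq_phi; apply: injhg; rewrite /= -!finE; congr (pr (upd_word _ _ _)).
  apply/ffunP => i; rewrite -(splitK i); case: (split i) => j /=; last first.
    by move/ffunP: eq_phi => /(_ j); rewrite !ffunE.
  have [jw|jw] := boolP (lshift k j \in take t w); last first.
    by rewrite !upd_word_notin // !startl; exact: pending.
  have jd : lshift k j \notin drop t w.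
    have : uniq (take t w ++ drop t w) by rewrite cat_take_drop perm_word_uniq.
    by rewrite cat_uniq => /and3P[_ /hasPn disj _]; apply: contraL jw => /disj.
  (* The rest of the word never touches an updated coordinate, so it already has its final value. *)
  have midE z : mid z (lshift k j) = h (g z) j.
    by rewrite -finE ffunE [RHS]upd_word_notin.
  by rewrite !midE; exact: updated.
have := leq_card _ injphi.
by rewrite !card_ffun !card_ord leq_exp2l.
Qed.

(** Indexing by naturals lets positions be computed without carrying bound proofs. *)
Definition at_nat (T : Type) (d : T) (n : nat) (x : 'I_n -> T) (p : nat) : T :=
  oapp x d (insub p).

Lemma at_natE (T : Type) (d : T) n (x : 'I_n -> T) (i : 'I_n) : at_nat d x i = x i.
Proof. by rewrite /at_nat valK. Qed.

Section HardMap.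
Variables (n q m : nat).
Hypothesis le_3m_n : 3 * m <= n.

Local Notation vecn := (vec n q.+2).
Local Notation tup := ((m + m).-tuple bool).

Implicit Types (t : tup) (x : vecn) (y : vec m q.+2).

(* [C] consists of the coordinates [p < m], and position [p] of a bit string
   refers to the coordinate [m + p] of [D]. *)
Definition bit t p := nth false t p.
Definition ones t := [seq p <- iota 0 (m + m) | bit t p].
Definition zeros t := [seq p <- iota 0 (m + m) | ~~ bit t p].
Definition letter (b : bool) : 'I_q.+2 := inord b.

Definition at_ (x : vecn) p : 'I_q.+2 := at_nat ord0 x p.

Definition in_cube t x :=
  [&& size (ones t) == m,
      all (fun p => at_ x p == letter (bit t p)) (iota 0 m) &
      all (fun j => at_ x (m + nth 0 (ones t) j) == letter (bit t (m + j))) (iota 0 m)].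

Definition cube_point t y : vecn :=
  [ffun i : 'I_n =>
    if i < m then letter (bit t i)
    else if i < 3 * m then
      if bit t (i - m) then letter (bit t (m + index (i - m) (ones t)))
      else at_nat ord0 y (index (i - m) (zeros t))
    else ord0].

Definition copy t x : vecn :=
  [ffun i : 'I_n =>
    if (m <= i < 3 * m) && bit t (i - m)
    then at_ x (m + nth 0 (zeros t) (index (i - m) (ones t))) else ord0].

Definition hard_map : Fmap n q.+2 := fun x =>
  if [pick t | in_cube t x] is Some t then copy t x else [ffun=> ord0].

Lemma letter_inj : injective letter.
Proof.
have letterE b : letter b = b :> nat by rewrite inordK //; case: b.
by move=> a b /(congr1 val); rewrite /= !letterE; case: a b => [] [].
Qed.

Lemma mem_ones t p : (p \in ones t) = (p < m + m) && bit t p.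
Proof. by rewrite mem_filter mem_iota add0n andbC. Qed.

Lemma mem_zeros t p : (p \in zeros t) = (p < m + m) && ~~ bit t p.
Proof. by rewrite mem_filter mem_iota add0n andbC. Qed.

Lemma size_ones_zeros t : size (ones t) + size (zeros t) = m + m.
Proof. by rewrite !size_filter count_predC size_iota. Qed.

Lemma at_ffun (F : 'I_n -> 'I_q.+2) p (lt_pn : p < n) :
  at_ [ffun i => F i] p = F (Ordinal lt_pn).
Proof. by rewrite /at_ /at_nat insubT /= ffunE. Qed.

Lemma cube_point_in_cube t y : size (ones t) = m -> in_cube t (cube_point t y).
Proof.
move=> szt; apply/and3P; split; first exact/eqP.
  apply/allP => p; rewrite mem_iota /= add0n => lt_pm.
  have lt_pn : p < n by lia.
  by rewrite at_ffun /= lt_pm.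
apply/allP => j; rewrite mem_iota /= add0n => lt_jm.
have: nth 0 (ones t) j \in ones t by rewrite mem_nth // szt.
rewrite mem_ones => /andP[lt_p bit_p].
have lt_pn : m + nth 0 (ones t) j < n by lia.
rewrite at_ffun /= ltnNge leq_addr /= addKn bit_p index_uniq ?szt //; last first.
  by rewrite filter_uniq ?iota_uniq.
by rewrite ifT //; lia.
Qed.

(** Locates the one of index [j] when only the bits before [p] are known. *)
Lemma nth_ones_prefix t p j : p <= m + m ->
  j < count (bit t) (iota 0 p) ->
  nth 0 (ones t) j = nth 0 [seq r <- iota 0 p | bit t r] j.
Proof.
move=> le_p lt_j.
have -> : ones t = [seq r <- iota 0 p ++ iota p (m + m - p) | bit t r].
  by rewrite -[in iota p](add0n p) -iotaD subnKC.
by rewrite filter_cat nth_cat size_filter lt_j.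
Qed.

(* A prefix of length [m + j] with at most [j] ones already contains all [m] zeros. *)
Lemma bit_after_zeros t j : size (ones t) = m -> j < m ->
  count (bit t) (iota 0 (m + j)) <= j -> bit t (m + j).
Proof.
move=> szt lt_jm le_j; apply/negPn/negP => zero_p.
have := size_ones_zeros t; rewrite szt => /addnI.
have -> : zeros t = [seq r <- iota 0 (m + j) ++ iota (m + j) (m - j) | ~~ bit t r].
  by rewrite -[in iota (m + j)](add0n (m + j)) -iotaD; congr filter; congr iota; lia.
have -> : m - j = (m - j.+1).+1 by lia.
rewrite filter_cat /= zero_p size_cat /=.
have := count_predC (bit t) (iota 0 (m + j)); rewrite size_iota size_filter.
rewrite (@eq_count _ (fun r => ~~ bit t r) (predC (bit t))) //; lia.
Qed.

Lemma in_cube_inj t t' x : in_cube t x -> in_cube t' x -> t = t'.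
Proof.
case/and3P => /eqP szt /allP ctl /allP dat /and3P[/eqP szt' /allP ctl' /allP dat'].
suff eq_bit p : p < m + m -> bit t p = bit t' p.
  apply/val_inj/(@eq_from_nth _ false) => [|p]; first by rewrite !size_tuple.
  by rewrite size_tuple; exact: eq_bit.
elim/ltn_ind: p => p IHp lt_p.
have [lt_pm|le_mp] := ltnP p m.
  have pm : p \in iota 0 m by rewrite mem_iota.
  by apply: letter_inj; rewrite -(eqP (ctl _ pm)) -(eqP (ctl' _ pm)).
have [j def_p] : exists j, p = m + j by exists (p - m); lia.
have lt_jm : j < m by lia.
have eq_pre : {in iota 0 p, bit t =1 bit t'}.
  by move=> r; rewrite mem_iota add0n => lt_r; apply: IHp => //; lia.
have eq_ct := eq_in_count eq_pre.
(* Bit [m + j] is stored at the one of index [j]. If that one lies before [p], its place is known by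
   induction and the bit can be read; otherwise the zeros are exhausted and the bit must be 1. *)
have [le_j|lt_j] := leqP (count (bit t) (iota 0 p)) j.
  by rewrite def_p in eq_ct le_j *; rewrite !bit_after_zeros // -eq_ct.
have jm : j \in iota 0 m by rewrite mem_iota.
apply: letter_inj; rewrite def_p -(eqP (dat _ jm)) -(eqP (dat' _ jm)).
by rewrite !(@nth_ones_prefix _ p) -?eq_ct // ?(eq_in_filter eq_pre) // ltnW.
Qed.

Lemma hard_map_cube t y : size (ones t) = m ->
  hard_map (cube_point t y) = copy t (cube_point t y).
Proof.
move=> szt; rewrite /hard_map; case: pickP => [t' t'x|/(_ t)].
  by rewrite (in_cube_inj t'x (cube_point_in_cube y szt)).
by rewrite cube_point_in_cube.
Qed.

Lemma hard_map_one t y (j : 'I_m) : size (ones t) = m ->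
  at_ (hard_map (cube_point t y)) (m + nth 0 (ones t) j) = y j.
Proof.
move=> szt; rewrite hard_map_cube //.
have szz : size (zeros t) = m by have := size_ones_zeros t; lia.
have: nth 0 (ones t) j \in ones t by rewrite mem_nth ?szt.
have: nth 0 (zeros t) j \in zeros t by rewrite mem_nth ?szz.
rewrite mem_ones mem_zeros => /andP[lt_z bit_z] /andP[lt_o bit_o].
have o_n : m + nth 0 (ones t) j < n by lia.
have z_n : m + nth 0 (zeros t) j < n by lia.
rewrite at_ffun /= addKn bit_o andbT ifT; last by lia.
rewrite index_uniq ?szt ?filter_uniq ?iota_uniq //.
rewrite at_ffun /= addKn (negPf bit_z) ltnNge leq_addr /= ifT; last by lia.
by rewrite index_uniq ?szz ?filter_uniq ?iota_uniq // at_natE.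
Qed.

Lemma hard_map_cube_inj t : size (ones t) = m ->
  injective (hard_map \o cube_point t).
Proof.
move=> szt y y' /= eq_h; apply/ffunP => j.
by rewrite -(hard_map_one y j szt) eq_h hard_map_one.
Qed.

Lemma hard_map_bound : kappa_min_ge hard_map m.
Proof.
move=> k [f [s seqf]].
pose D := iota m (m + m); pose w := perm_word s.
pose W := [seq val i | i <- w].
have uW : uniq W by rewrite map_inj_uniq ?perm_word_uniq //; exact: val_inj.
have DW : {subset D <= W}.
  move=> p; rewrite mem_iota => /andP[_ lt_p].
  have lt_pn : p < n + k by lia.
  by apply/mapP; exists (Ordinal lt_pn); rewrite ?mem_perm_word.
(* All [m + m] elements of [D] occur in [W], so their count passes through [m]. *)
have [tau tauP] : exists tau, count [in D] (take tau W) = m.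
  apply: count_take_ivt; rewrite count_mem_swap ?iota_uniq //.
  by move/allP: DW; rewrite all_count size_iota => /eqP->; exact: leq_addr.
pose V := take tau W.
have memV i : (i \in take tau w) = (val i \in V).
  by rewrite /V /W -map_take mem_map //; exact: val_inj.
have sz_t : size (mkseq (fun p => m + p \notin V) (m + m)) == m + m.
  by rewrite size_mkseq.
pose t : tup := Tuple sz_t.
have bitE p : p < m + m -> bit t p = (m + p \notin V).
  by move=> lt_p; rewrite /bit /= nth_mkseq.
have szt : size (ones t) = m.
  rewrite size_filter (@eq_in_count _ _ (predC [pred p | m + p \in V])); last first.
    by move=> p; rewrite mem_iota add0n => /= lt_p; rewrite bitE.
  have := count_predC [pred p | m + p \in V] (iota 0 (m + m)).
  rewrite size_iota.
  have -> : count [pred p | m + p \in V] (iota 0 (m + m)) = m; last by move=> /addnI.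
  rewrite -[RHS]tauP count_mem_swap ?iota_uniq ?take_uniq //.
  by rewrite /D -[in iota m](addn0 m) iotaDl count_map; apply: eq_count.
apply: (confusion_bound (t := tau) (g := cube_point t) seqf).
- exact: hard_map_cube_inj.
(* An updated coordinate is outside [D] or marked 0, and there [copy] writes 0. *)
- move=> i y y'; rewrite memV /= => iV.
  rewrite !hard_map_cube // !ffunE; case: andP => // -[i_D].
  by rewrite bitE ?subnKC ?iV //; lia.
(* A pending coordinate of [D] is marked 1 and holds a letter of [t]; outside [D] the cube point
   does not depend on [y] either. *)
move=> i y y'; rewrite memV /= => iV; rewrite !ffunE.
case: ltnP => // le_mi; case: ltnP => // lt_i3.
by rewrite bitE ?subnKC ?iV //; lia.
Qed.

End HardMap.

Theorem mainTheorem5 (q n : nat) (hq : 2 <= q) : kappa_max_ge n q (n %/ 3).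
Proof.
case: q hq => [|[|q]] // _.
exists (@hard_map n q (n %/ 3)); apply: hard_map_bound; lia.
Qed.
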